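(* Let $F$ be a field of characteristic $0$ and let $a\in SMalc[X]$ be fixed. For $n\ge 1$ and elements $v_1,\ldots,v_n$ put $$u_n(v_1,\ldots,v_n)=\bigl([a,v_1,\ldots,v_{n-1}],a^2,v_n\bigr)-\bigl([a^2,v_1,\ldots,v_{n-1}],a,v_n\bigr).$$ Then in the algebra $Alt[X]$, for all $n\ge 2$, all $x_1,\ldots,x_n\in X$ and all $b,c\in SMalc[X]$: (1) $u_n(x_1,\ldots,x_n)\in Z$; (2) $u_n(x_1,\ldots,x_n)$ is skew-symmetric in $x_1,\ldots,x_n$; (3) $u_n(x_1,\ldots,x_{n-1},[b,c])=0$.
   Context: $X=\{x_1,x_2,\ldots\}$ is a countably infinite set of free generators. $Alt[X]$ is the free alternative $F$-algebra on $X$. $SMalc[X]\subset Alt[X]$ is the smallest $F$-subspace containing $X$ and closed under the commutator $[p,q]=pq-qp$ (product in $Alt[X]$). Long commutators are left-normed: $[p,q_1,\ldots,q_k]=[\ldots[[p,q_1],q_2],\ldots,q_k]$ (equal to $p$ if $k=0$). Associator: $(p,q,r)=(pq)r-p(qr)$. The associative center of $Alt[X]$ is $N=\{p : (p,Alt[X],Alt[X])=0\}$ and the center is $Z=\{p\in N : [p,Alt[X]]=0\}$. *)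

(* Defs.v *)
From HB Require Import structures.
From mathcomp Require Import all_boot all_order all_algebra.
From mathcomp Require Import boolp.

Set Implicit Arguments.
Unset Strict Implicit.
Unset Printing Implicit Defensive.

Import GRing.Theory.
Local Open Scope ring_scope.
Local Open Scope quotient_scope.

HB.mixin Record isAltAlgebra (F : fieldType) A of GRing.Lmodule F A := {
  amul : A -> A -> A;
  amulDl : forall x y z, amul (x + y) z = amul x z + amul y z;
  amulDr : forall x y z, amul x (y + z) = amul x y + amul x z;
  amulZl : forall (k : F) x y, amul (k *: x) y = k *: amul x y;
  amulZr : forall (k : F) x y, amul x (k *: y) = k *: amul x y;
  amul_altl : forall x y, amul (amul x x) y = amul x (amul x y);
  amul_altr : forall x y, amul (amul y x) x = amul y (amul x x)
}.

(* Alternative algebras are not required to have a unit. *)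
#[short(type="altAlgType")]
HB.structure Definition AltAlgebra (F : fieldType) :=
  { A of isAltAlgebra F A & GRing.Lmodule F A }.

Notation "x ** y" := (amul x y) (at level 40, left associativity) : ring_scope.

Section AltAlgebraNotions.
Variables (F : fieldType) (A : altAlgType F).
Implicit Types (p q r x : A) (s : seq A).

Definition acomm p q : A := p ** q - q ** p.

Definition assoc p q r : A := (p ** q) ** r - p ** (q ** r).

(* Left-normed: [p, q1, ..., qk]. *)
Definition lcomm p s : A := foldl acomm p s.

Definition assoc_center p : Prop := forall q r, assoc p q r = 0.

Definition center p : Prop := assoc_center p /\ forall q, acomm p q = 0.

(* u_n(v_1, ..., v_n) is [u_elt a [:: v_1; ...; v_n]]; with s = x :: s', the   *)
(* list [belast x s'] is v_1, ..., v_{n-1} and [last x s'] is v_n. The value   *)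
(* at the empty list is a dummy one.                                           *)
Definition u_elt (a : A) s : A :=
  if s is x :: s' then
    assoc (lcomm a (belast x s')) (a ** a) (last x s')
    - assoc (lcomm (a ** a) (belast x s')) a (last x s')
  else 0.

Lemma u_elt_rcons (a : A) s x :
  u_elt a (rcons s x) =
    assoc (lcomm a s) (a ** a) x - assoc (lcomm (a ** a) s) a x.
Proof. by case: s => [|y s] //=; rewrite belast_rcons last_rcons. Qed.

(* The least subspace containing the family e and closed under commutators. *)
Inductive comm_span (I : Type) (e : I -> A) : A -> Prop :=
| comm_span_gen i : comm_span e (e i)
| comm_span0 : comm_span e 0
| comm_spanD p q : comm_span e p -> comm_span e q -> comm_span e (p + q)
| comm_spanZ (k : F) p : comm_span e p -> comm_span e (k *: p)
| comm_span_comm p q :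
    comm_span e p -> comm_span e q -> comm_span e (acomm p q).

End AltAlgebraNotions.

Section FreeAlternative.
Variable F : fieldType.

Inductive aterm : Type :=
| TVar of nat
| TZero
| TAdd of aterm & aterm
| TScale of F & aterm
| TMul of aterm & aterm.

(* The congruence generated by the identities of alternative F-algebras; the   *)
(* opposite of t is encoded as TScale (-1) t.                                  *)
Inductive aterm_eq : aterm -> aterm -> Prop :=
| teq_refl t : aterm_eq t t
| teq_sym t u : aterm_eq t u -> aterm_eq u t
| teq_trans t u v : aterm_eq t u -> aterm_eq u v -> aterm_eq t v
| teq_add t t' u u' :
    aterm_eq t t' -> aterm_eq u u' -> aterm_eq (TAdd t u) (TAdd t' u')
| teq_scale k t t' : aterm_eq t t' -> aterm_eq (TScale k t) (TScale k t')
| teq_mul t t' u u' :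
    aterm_eq t t' -> aterm_eq u u' -> aterm_eq (TMul t u) (TMul t' u')
| teq_addA t u v : aterm_eq (TAdd t (TAdd u v)) (TAdd (TAdd t u) v)
| teq_addC t u : aterm_eq (TAdd t u) (TAdd u t)
| teq_add0 t : aterm_eq (TAdd TZero t) t
| teq_addN t : aterm_eq (TAdd (TScale (-1) t) t) TZero
| teq_scaleA k l t : aterm_eq (TScale k (TScale l t)) (TScale (k * l) t)
| teq_scale1 t : aterm_eq (TScale 1 t) t
| teq_scaleDr k t u :
    aterm_eq (TScale k (TAdd t u)) (TAdd (TScale k t) (TScale k u))
| teq_scaleDl k l t :
    aterm_eq (TScale (k + l) t) (TAdd (TScale k t) (TScale l t))
| teq_mulDl t u v : aterm_eq (TMul (TAdd t u) v) (TAdd (TMul t v) (TMul u v))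
| teq_mulDr t u v : aterm_eq (TMul t (TAdd u v)) (TAdd (TMul t u) (TMul t v))
| teq_mulZl k t u : aterm_eq (TMul (TScale k t) u) (TScale k (TMul t u))
| teq_mulZr k t u : aterm_eq (TMul t (TScale k u)) (TScale k (TMul t u))
| teq_altl t u : aterm_eq (TMul (TMul t t) u) (TMul t (TMul t u))
| teq_altr t u : aterm_eq (TMul (TMul u t) t) (TMul u (TMul t t)).

HB.instance Definition _ := gen_eqMixin aterm.
HB.instance Definition _ := gen_choiceMixin aterm.

Definition aterm_eqb (t u : aterm) : bool := `[< aterm_eq t u >].

Fact aterm_eqb_refl : reflexive aterm_eqb.
Proof. by move=> t; apply/asboolP; exact: teq_refl. Qed.

Fact aterm_eqb_sym : symmetric aterm_eqb.
Proof. by move=> t u; apply/asboolP/asboolP; exact: teq_sym. Qed.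

Fact aterm_eqb_trans : transitive aterm_eqb.
Proof.
by move=> u t v /asboolP tu /asboolP uv; apply/asboolP; exact: teq_trans tu uv.
Qed.

Canonical aterm_equiv :=
  EquivRel aterm_eqb aterm_eqb_refl aterm_eqb_sym aterm_eqb_trans.

(* The free (non-unital) alternative F-algebra on the countably infinite set   *)
(* of generators [agen 0], [agen 1], ...; see [Alt_universal].                 *)
Definition Alt := {eq_quot aterm_equiv}.

HB.instance Definition _ := Choice.on Alt.
HB.instance Definition _ : EqQuotient _ aterm_equiv Alt := EqQuotient.on Alt.

Lemma pi_AltP t u : aterm_eq t u <-> \pi_Alt t = \pi_Alt u.
Proof.
split=> [tu|/eqP]; first by apply/eqP; rewrite piE; apply/asboolP.
by rewrite piE => /asboolP.
Qed.

Lemma aterm_repr t : aterm_eq (repr (\pi_Alt t)) t.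
Proof. by apply/pi_AltP; rewrite reprK. Qed.

Definition Alt_add (x y : Alt) : Alt := \pi_Alt (TAdd (repr x) (repr y)).
Definition Alt_scale (k : F) (x : Alt) : Alt := \pi_Alt (TScale k (repr x)).
Definition Alt_mul (x y : Alt) : Alt := \pi_Alt (TMul (repr x) (repr y)).

Lemma Alt_addE t u : Alt_add (\pi_Alt t) (\pi_Alt u) = \pi_Alt (TAdd t u).
Proof. by apply/pi_AltP/teq_add; exact: aterm_repr. Qed.

Lemma Alt_scaleE k t : Alt_scale k (\pi_Alt t) = \pi_Alt (TScale k t).
Proof. by apply/pi_AltP/teq_scale; exact: aterm_repr. Qed.

Lemma Alt_mulE t u : Alt_mul (\pi_Alt t) (\pi_Alt u) = \pi_Alt (TMul t u).
Proof. by apply/pi_AltP/teq_mul; exact: aterm_repr. Qed.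

Lemma Alt_ind (P : Alt -> Prop) : (forall t, P (\pi_Alt t)) -> forall x, P x.
Proof. by move=> Ppi x; rewrite -[x]reprK; exact: Ppi. Qed.

Fact Alt_addA : associative Alt_add.
Proof.
elim/Alt_ind=> t; elim/Alt_ind=> u; elim/Alt_ind=> v.
by rewrite !Alt_addE; apply/pi_AltP; exact: teq_addA.
Qed.

Fact Alt_addC : commutative Alt_add.
Proof.
elim/Alt_ind=> t; elim/Alt_ind=> u.
by rewrite !Alt_addE; apply/pi_AltP; exact: teq_addC.
Qed.

Fact Alt_add0 : left_id (\pi_Alt TZero) Alt_add.
Proof.
by elim/Alt_ind=> t; rewrite Alt_addE; apply/pi_AltP; exact: teq_add0.
Qed.

Fact Alt_addN : left_inverse (\pi_Alt TZero) (Alt_scale (-1)) Alt_add.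
Proof.
elim/Alt_ind=> t; rewrite Alt_scaleE Alt_addE.
by apply/pi_AltP; exact: teq_addN.
Qed.

HB.instance Definition _ :=
  GRing.isZmodule.Build Alt Alt_addA Alt_addC Alt_add0 Alt_addN.

Fact Alt_scaleA k l x : Alt_scale k (Alt_scale l x) = Alt_scale (k * l) x.
Proof.
elim/Alt_ind: x => t.
by rewrite !Alt_scaleE; apply/pi_AltP; exact: teq_scaleA.
Qed.

Fact Alt_scale1 : left_id 1 Alt_scale.
Proof.
by elim/Alt_ind=> t; rewrite Alt_scaleE; apply/pi_AltP; exact: teq_scale1.
Qed.

Fact Alt_scaleDr : right_distributive Alt_scale +%R.
Proof.
move=> k; elim/Alt_ind=> t; elim/Alt_ind=> u.
rewrite /GRing.add /= !(Alt_scaleE, Alt_addE).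
by apply/pi_AltP; exact: teq_scaleDr.
Qed.

Fact Alt_scaleDl x : {morph Alt_scale^~ x : k l / k + l}.
Proof.
move=> k l; elim/Alt_ind: x => t.
rewrite [in RHS]/GRing.add /= !(Alt_scaleE, Alt_addE).
by apply/pi_AltP; exact: teq_scaleDl.
Qed.

HB.instance Definition _ :=
  GRing.Zmodule_isLmodule.Build F Alt
    Alt_scaleA Alt_scale1 Alt_scaleDr Alt_scaleDl.

Fact Alt_mulDl (x y z : Alt) : Alt_mul (x + y) z = Alt_mul x z + Alt_mul y z.
Proof.
elim/Alt_ind: x => t; elim/Alt_ind: y => u; elim/Alt_ind: z => v.
rewrite /GRing.add /= !(Alt_addE, Alt_mulE).
by apply/pi_AltP; exact: teq_mulDl.
Qed.

Fact Alt_mulDr (x y z : Alt) : Alt_mul x (y + z) = Alt_mul x y + Alt_mul x z.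
Proof.
elim/Alt_ind: x => t; elim/Alt_ind: y => u; elim/Alt_ind: z => v.
rewrite /GRing.add /= !(Alt_addE, Alt_mulE).
by apply/pi_AltP; exact: teq_mulDr.
Qed.

Fact Alt_mulZl k (x y : Alt) : Alt_mul (k *: x) y = k *: Alt_mul x y.
Proof.
elim/Alt_ind: x => t; elim/Alt_ind: y => u.
rewrite /GRing.scale /= !(Alt_scaleE, Alt_mulE).
by apply/pi_AltP; exact: teq_mulZl.
Qed.

Fact Alt_mulZr k (x y : Alt) : Alt_mul x (k *: y) = k *: Alt_mul x y.
Proof.
elim/Alt_ind: x => t; elim/Alt_ind: y => u.
rewrite /GRing.scale /= !(Alt_scaleE, Alt_mulE).
by apply/pi_AltP; exact: teq_mulZr.
Qed.

Fact Alt_altl x y : Alt_mul (Alt_mul x x) y = Alt_mul x (Alt_mul x y).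
Proof.
elim/Alt_ind: x => t; elim/Alt_ind: y => u.
by rewrite !Alt_mulE; apply/pi_AltP; exact: teq_altl.
Qed.

Fact Alt_altr x y : Alt_mul (Alt_mul y x) x = Alt_mul y (Alt_mul x x).
Proof.
elim/Alt_ind: x => t; elim/Alt_ind: y => u.
by rewrite !Alt_mulE; apply/pi_AltP; exact: teq_altr.
Qed.

HB.instance Definition _ :=
  isAltAlgebra.Build F Alt
    Alt_mulDl Alt_mulDr Alt_mulZl Alt_mulZr Alt_altl Alt_altr.

Definition agen (i : nat) : Alt := \pi_Alt (TVar i).

Definition SMalc : Alt -> Prop := comm_span agen.

Definition is_alt_morph (A B : altAlgType F) (g : A -> B) : Prop :=
  linear g /\ forall x y, g (x ** y) = g x ** g y.

Section Universal.
Variables (B : altAlgType F) (f : nat -> B).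

Fixpoint aterm_eval (t : aterm) : B :=
  match t with
  | TVar i => f i
  | TZero => 0
  | TAdd t u => aterm_eval t + aterm_eval u
  | TScale k t => k *: aterm_eval t
  | TMul t u => aterm_eval t ** aterm_eval u
  end.

Lemma aterm_eval_eq t u : aterm_eq t u -> aterm_eval t = aterm_eval u.
Proof.
elim=> //=.
- by move=> ? ? ? _ -> _ ->.
- by move=> ? ? ? ? _ -> _ ->.
- by move=> ? ? ? _ ->.
- by move=> ? ? ? ? _ -> _ ->.
- by move=> *; rewrite addrA.
- by move=> *; rewrite addrC.
- by move=> *; rewrite add0r.
- by move=> *; rewrite scaleN1r addNr.
- by move=> *; rewrite scalerA.
- by move=> *; rewrite scale1r.
- by move=> *; rewrite scalerDr.
- by move=> *; rewrite scalerDl.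
- by move=> *; rewrite amulDl.
- by move=> *; rewrite amulDr.
- by move=> *; rewrite amulZl.
- by move=> *; rewrite amulZr.
- by move=> *; rewrite amul_altl.
- by move=> *; rewrite amul_altr.
Qed.

Definition Alt_lift (x : Alt) : B := aterm_eval (repr x).

Lemma Alt_liftE t : Alt_lift (\pi_Alt t) = aterm_eval t.
Proof. by apply: aterm_eval_eq; exact: aterm_repr. Qed.

Lemma addAltE t u : \pi_Alt (TAdd t u) = \pi_Alt t + \pi_Alt u.
Proof. by rewrite /GRing.add /= Alt_addE. Qed.

Lemma scaleAltE k t : \pi_Alt (TScale k t) = k *: \pi_Alt t.
Proof. by rewrite /GRing.scale /= Alt_scaleE. Qed.

Lemma mulAltE t u : \pi_Alt (TMul t u) = \pi_Alt t ** \pi_Alt u.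
Proof. by rewrite /amul /= Alt_mulE. Qed.

Theorem Alt_universal :
  exists! g : Alt -> B, is_alt_morph g /\ forall i, g (agen i) = f i.
Proof.
exists Alt_lift; split.
  split; last by move=> i; rewrite Alt_liftE.
  split=> [k|]; elim/Alt_ind=> t; elim/Alt_ind=> u.
    by rewrite -scaleAltE -addAltE !Alt_liftE.
  by rewrite -mulAltE !Alt_liftE.
move=> g [[glin gmul] gf]; apply: funext; elim/Alt_ind=> t.
have gD x y : g (x + y) = g x + g y by have := glin 1 x y; rewrite !scale1r.
have g0 : g 0 = 0 by apply: (addrI (g 0)); rewrite -gD !addr0.
rewrite Alt_liftE; elim: t => /=.
- by move=> i; rewrite -gf.
- by rewrite -g0.
- by move=> t IHt u IHu; rewrite IHt IHu -gD addAltE.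
- by move=> k t IHt; rewrite IHt scaleAltE -[k *: \pi_Alt t]addr0 glin g0 addr0.
- by move=> t IHt u IHu; rewrite IHt IHu -gmul mulAltE.
Qed.

End Universal.

End FreeAlternative.

Arguments agen {F} i.
Arguments SMalc {F} p.

(* Main.v *)
Require Import Defs.
From Stdlib Require Import ZArith.
From mathcomp Require Import all_boot all_order all_fingroup all_algebra.
From mathcomp Require Import ssrZ zify.
Set Implicit Arguments.
Unset Strict Implicit.
Unset Printing Implicit Defensive.
Import GRing.Theory.
Local Open Scope ring_scope.

(** Let A be an alternative algebra over a field of characteristic 0. Its
    commutator algebra is a Malcev algebra, with Jacobian
    [J(x, y, z) = 6 (x, y, z)]. For a word [P = v_1 ... v_(n-1)] write
    [xP = [x, v_1, ..., v_(n-1)]]; then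
    [6 u_n(P, v) = J(aP, a^2, v) - J(a^2 P, a, v)]. All the arguments below hold
    for arbitrary elements of A, and only concern the Malcev structure once
    [u_1 = u_2 = 0] has been checked.

    The core is an induction showing that [u_n] is central and vanishes when
    its last argument is a commutator. Fix a prefix [P] of length [n - 3] and
    consider, for words [S] and [T], the forms
    [J(S, T; v) = J(aPS, a^2 T, v) - J(a^2 PS, aT, v)] and
    [C(S, T) = [aPS, a^2 T] - [a^2 PS, aT]]; here [J(1, 1; v)], [J(s, 1; v)] and
    [J(sv, 1; w)] are multiples of [u_(n-2)], [u_(n-1)] and [u_n]. The Malcev
    identities of degree 4 move a letter from [S] to [T] ([pairJ_acomm_last])
    and make [J(sv, 1; w)] skew-symmetric in [v] and [w] ([pairJ_rcons_skew]),
    and the fact that [R_[v,w] + [R_v, R_w]] is a derivation of the Malcev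
    algebra computes [J(C(S, t), v, w)] from forms [J(S', T; x)] ([pairC_jac]).
    - For [S = 1] this gives [J(C(1, t), v, w) = J(tv, 1; w) + J(vt, 1; w)]. The
      left-hand side is skew-symmetric in [v] and [w], hence so is the right
      one; with skew-symmetry in the last two letters this makes [J(sv, 1; w)]
      skew-symmetric in all its letters, and puts [C(1, t)] in the Lie nucleus
      [{x : J(x, A, A) = 0}], which is an ideal ([jac_nucleus_acomm]).
    - Multiplying [C(1, t)] by [s] shows that [C(s, t) - C(t, s)] is in the
      Lie nucleus ([jac_pairC11_sym]). Written out, this is a linear relation
      between [g(a, b, c; d) = [J(ab, 1; c), d]] and
      [h(a, b; c, d) = J(ab, 1; [c, d])] ([g4_h4_relation]). The relation
      makes [g] skew-symmetric in its four arguments with [3h = 4g]; as the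
      cyclic sum of [h] over three arguments is zero ([h4_cycle]), both [g] and [h] vanish.

    A central element for the commutator is in the center, since
    [6 (u, x, y) = J(u, x, y)]. Finally, [u_n] is skew-symmetric in its last
    three arguments by the induction; the Sagle identity shows that it is
    invariant under cyclic permutations of three consecutive arguments among the
    first [n - 1], because the correction terms have a commutator as an argument
    and come from [u_(n-1)] or [u_(n-2)]. These permutations carry
    skew-symmetry over to all arguments. *)

(** * Normal forms in free nonassociative rings

    Identities of free nonassociative rings are decided by reflection: both
    sides are read as expressions in numbered atoms, and the normal form of
    their difference is computed. Linear combinations of known identities are
    then checked by subtracting them one at a time from the goal. *)

(** Nonassociative monomials, in variables numbered by [nat]. *)
Inductive mono : Type := MVar of nat | MMul of mono & mono.

(** Polynomials with integer coefficients, as lists sorted by [mono_cmp]. *)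
Definition npoly := seq (Z * mono).

(** Expressions; [NScale] is multiplication by an integer. *)
Inductive nexpr : Type :=
| NVar of nat
| NZero
| NAdd of nexpr & nexpr
| NOpp of nexpr
| NScale of int & nexpr
| NMul of nexpr & nexpr.

(** A total order on monomials; only [mono_cmp_eq] is needed for soundness. *)
Fixpoint mono_cmp (m n : mono) : comparison :=
  match m, n with
  | MVar i, MVar j => Nat.compare i j
  | MVar _, MMul _ _ => Lt
  | MMul _ _, MVar _ => Gt
  | MMul m1 m2, MMul n1 n2 =>
      match mono_cmp m1 n1 with Eq => mono_cmp m2 n2 | o => o end
  end.

Lemma mono_cmp_eq m n : mono_cmp m n = Eq -> m = n.
Proof.
elim: m n => [i|m1 IH1 m2 IH2] [j|n1 n2] //=.
  by move/PeanoNat.Nat.compare_eq => ->.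
by case E: (mono_cmp m1 n1) => // /IH2 ->; rewrite (IH1 _ E).
Qed.

Definition npoly_cons (c : Z) (m : mono) (p : npoly) : npoly :=
  if c is Z0 then p else (c, m) :: p.

(** Sum of two polynomials, by merging the sorted lists. *)
Fixpoint npoly_add (p : npoly) {struct p} : npoly -> npoly :=
  fix add_p (q : npoly) {struct q} : npoly :=
  match p, q with
  | [::], _ => q
  | _, [::] => p
  | (c, m) :: p', (d, n) :: q' =>
      match mono_cmp m n with
      | Eq => npoly_cons (Z.add c d) m (npoly_add p' q')
      | Lt => (c, m) :: npoly_add p' q
      | Gt => (d, n) :: add_p q'
      end
  end.

Definition npoly_scale (c : Z) (p : npoly) : npoly :=
  if c is Z0 then [::] else [seq (Z.mul c t.1, t.2) | t <- p].

Arguments npoly_scale : simpl never.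

Fixpoint npoly_mul (p q : npoly) : npoly :=
  if p is (c, m) :: p' then
    npoly_add [seq (Z.mul c t.1, MMul m t.2) | t <- q] (npoly_mul p' q)
  else [::].

(** The normal form of an expression. *)
Fixpoint nnorm (e : nexpr) : npoly :=
  match e with
  | NVar i => [:: (Zpos xH, MVar i)]
  | NZero => [::]
  | NAdd e1 e2 => npoly_add (nnorm e1) (nnorm e2)
  | NOpp e1 => npoly_scale (Zneg xH) (nnorm e1)
  | NScale c e1 => npoly_scale (Z_of_int c) (nnorm e1)
  | NMul e1 e2 => npoly_mul (nnorm e1) (nnorm e2)
  end.

Section NonassocNormalForm.
Variables (F : fieldType) (A : altAlgType F) (env : seq A).
Implicit Types (x y : A) (c d : Z).

Definition zscale c x : A := x *~ int_of_Z c.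

Lemma zscaleD c d x : zscale (Z.add c d) x = zscale c x + zscale d x.
Proof. by rewrite /zscale (raddfD int_of_Z) mulrzDr. Qed.

Lemma zscaleM c d x : zscale (Z.mul c d) x = zscale c (zscale d x).
Proof. by rewrite /zscale (rmorphM int_of_Z) mulrC mulrzA. Qed.

Lemma amul0l x : 0 ** x = 0.
Proof. by apply: (addrI (0 ** x)); rewrite -amulDl !addr0. Qed.

Lemma amul0r x : x ** 0 = 0.
Proof. by apply: (addrI (x ** 0)); rewrite -amulDr !addr0. Qed.

Lemma amulMzl x y (k : int) : (x *~ k) ** y = (x ** y) *~ k.
Proof. by rewrite -!(scaler_int) amulZl. Qed.

Lemma amulMzr x y (k : int) : x ** (y *~ k) = (x ** y) *~ k.
Proof. by rewrite -!(scaler_int) amulZr. Qed.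

(** The values of monomials, polynomials and expressions at the atoms [env]. *)
Fixpoint mono_eval (m : mono) : A :=
  match m with
  | MVar i => nth 0 env i
  | MMul m1 m2 => mono_eval m1 ** mono_eval m2
  end.

Fixpoint npoly_eval (p : npoly) : A :=
  if p is (c, m) :: p' then zscale c (mono_eval m) + npoly_eval p' else 0.

Fixpoint nexpr_eval (e : nexpr) : A :=
  match e with
  | NVar i => nth 0 env i
  | NZero => 0
  | NAdd e1 e2 => nexpr_eval e1 + nexpr_eval e2
  | NOpp e1 => - nexpr_eval e1
  | NScale c e1 => nexpr_eval e1 *~ c
  | NMul e1 e2 => nexpr_eval e1 ** nexpr_eval e2
  end.

Lemma npoly_eval_cons c m p :
  npoly_eval (npoly_cons c m p) = zscale c (mono_eval m) + npoly_eval p.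
Proof. by case: c => //=; rewrite /zscale mulr0z add0r. Qed.

Lemma npoly_eval_add p q :
  npoly_eval (npoly_add p q) = npoly_eval p + npoly_eval q.
Proof.
elim: p q => [|[c m] p IHp] q /=; first by rewrite add0r; case: q.
elim: q => [|[d n] q IHq] /=; rewrite ?add0r ?addr0 //.
case E: (mono_cmp m n) => /=.
- rewrite npoly_eval_cons IHp (mono_cmp_eq E) zscaleD.
  by rewrite -!addrA; congr (_ + _); rewrite addrCA.
- by rewrite IHp /= !addrA.
- by rewrite IHq /= addrCA.
Qed.

Lemma npoly_eval_scale c p :
  npoly_eval (npoly_scale c p) = zscale c (npoly_eval p).
Proof.
have E p' : npoly_eval [seq (Z.mul c t.1, t.2) | t <- p'] =
            zscale c (npoly_eval p').
  elim: p' => [|[d m] p' IH] /=; first by rewrite /zscale mul0rz.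
  by rewrite IH zscaleM -mulrzDl.
by case: c E => [|c|c] E; rewrite -?E //= /zscale mulr0z.
Qed.

Lemma npoly_eval_mul p q :
  npoly_eval (npoly_mul p q) = npoly_eval p ** npoly_eval q.
Proof.
elim: p => [|[c m] p IHp] /=; first by rewrite amul0l.
rewrite npoly_eval_add IHp amulDl; congr (_ + _).
elim: {IHp} q => [|[d n] q IHq] /=; first by rewrite amul0r.
rewrite IHq amulDr; congr (_ + _).
by rewrite zscaleM /zscale amulMzl amulMzr.
Qed.

Lemma nnorm_eval e : npoly_eval (nnorm e) = nexpr_eval e.
Proof.
elim: e => [i||e1 IH1 e2 IH2|e IH|c e IH|e1 IH1 e2 IH2] //=.
- by rewrite addr0.
- by rewrite npoly_eval_add IH1 IH2.
- by rewrite npoly_eval_scale IH; exact: mulrN1z.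
- by rewrite npoly_eval_scale IH /zscale Z_of_intK.
- by rewrite npoly_eval_mul IH1 IH2.
Qed.

Definition nexpr_eqb (l r : nexpr) : bool :=
  if nnorm (NAdd l (NOpp r)) is [::] then true else false.

(** An identity of free nonassociative rings holds in every algebra. *)
Lemma nexpr_eqP l r : nexpr_eqb l r = true -> nexpr_eval l = nexpr_eval r.
Proof.
rewrite /nexpr_eqb; case E: nnorm => // _; apply/eqP; rewrite -subr_eq0.
by apply/eqP; have := nnorm_eval (NAdd l (NOpp r)); rewrite E.
Qed.

Lemma lincomb_step (c : int) x y l r : x = y -> l - (x - y) *~ c = r -> l = r.
Proof. by move=> ->; rewrite subrr mul0rz subr0. Qed.

Lemma mulrn_char0_eq0 n x (charF0 : [pchar F] =i pred0) :
  x *+ n.+1 = 0 -> x = 0.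
Proof.
rewrite -scaler_nat => /eqP; rewrite scaler_eq0 => /orP[|/eqP //].
by rewrite (iffLR (pcharf0P F) charF0).
Qed.

End NonassocNormalForm.

(** The position of [x] in the list [env]. *)
Ltac nar_find env x :=
  match env with
  | cons x _ => constr:(0%N)
  | cons _ ?env' => let n := nar_find env' x in constr:(S n)
  end.

(** The list [env], with [x] added unless it is already there. *)
Ltac nar_atom env x :=
  match constr:(Set) with
  | _ => let n := nar_find env x in env
  | _ => constr:(cons x env)
  end.

(** The list [env] extended by the atoms of [e]. *)
Ltac nar_env env e :=
  match e with
  | @GRing.zero _ => env
  | @GRing.add _ ?x ?y => let env1 := nar_env env x in nar_env env1 y
  | @GRing.opp _ ?x => nar_env env x
  | @GRing.natmul _ ?x _ => nar_env env x
  | @intmul _ ?x _ => nar_env env x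
  | @amul _ _ ?x ?y => let env1 := nar_env env x in nar_env env1 y
  | @acomm _ _ ?x ?y => let env1 := nar_env env x in nar_env env1 y
  | ?x => nar_atom env x
  end.

(** The expression whose value at [env] is [e]; a commutator is expanded. *)
Ltac nar_quote env e :=
  match e with
  | @GRing.zero _ => constr:(NZero)
  | @GRing.add _ ?x ?y =>
      let a := nar_quote env x in let b := nar_quote env y in
      constr:(NAdd a b)
  | @GRing.opp _ ?x => let a := nar_quote env x in constr:(NOpp a)
  | @GRing.natmul _ ?x ?n =>
      let a := nar_quote env x in constr:(NScale (Posz n) a)
  | @intmul _ ?x ?c => let a := nar_quote env x in constr:(NScale c a)
  | @amul _ _ ?x ?y =>
      let a := nar_quote env x in let b := nar_quote env y in
      constr:(NMul a b)
  | @acomm _ _ ?x ?y =>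
      let a := nar_quote env x in let b := nar_quote env y in
      constr:(NAdd (NMul a b) (NOpp (NMul b a)))
  | ?x => let n := nar_find env x in constr:(NVar n)
  end.

(** Proves an equation that holds in all nonassociative rings, for all values
    of its subterms other than sums, integer multiples, products and
    commutators. *)
Ltac nar :=
  match goal with
  | |- @eq ?T ?l ?r =>
      let env := nar_env (@nil T) l in
      let env := nar_env env r in
      let a := nar_quote env l in
      let b := nar_quote env r in
      apply: (@nexpr_eqP _ _ env a b); vm_compute; reflexivity
  end.

(** [lin c H] subtracts [c] times the equation [H] from the goal, leaving its
    right-hand side unchanged. *)
Tactic Notation "lin" uconstr(c) uconstr(H) :=
  refine (@lincomb_step _ _ c _ _ _ _ H _).

(** * Alternative and Malcev identities *)

Section Alternative.
Variables (F : fieldType) (A : altAlgType F).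
Hypothesis charF0 : [pchar F] =i pred0.
Implicit Types (a b c d p q r s t u v w x y z : A).

Lemma mulr2n_char0_inj x y : x *+ 2 = y *+ 2 -> x = y.
Proof.
move=> /eqP; rewrite -subr_eq0 -mulrnBl => /eqP.
by move=> /(mulrn_char0_eq0 charF0) /eqP; rewrite subr_eq0 => /eqP.
Qed.

Lemma amul_congl z x y : x = y -> x ** z = y ** z.
Proof. by move->. Qed.

Lemma amul_congr z x y : x = y -> z ** x = z ** y.
Proof. by move->. Qed.

Lemma assoc_xxz x z : assoc x x z = 0.
Proof. by rewrite /assoc amul_altl subrr. Qed.

Lemma assoc_zxx x z : assoc z x x = 0.
Proof. by rewrite /assoc amul_altr subrr. Qed.

Lemma assocC12 x y z : assoc x y z + assoc y x z = 0.
Proof.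
have := assoc_xxz (x + y) z; rewrite /assoc => H.
lin 1 H; lin (-1) (assoc_xxz x z); lin (-1) (assoc_xxz y z).
rewrite /assoc; nar.
Qed.

Lemma assocC23 x y z : assoc x y z + assoc x z y = 0.
Proof.
have := assoc_zxx (y + z) x; rewrite /assoc => H.
lin 1 H; lin (-1) (assoc_zxx y x); lin (-1) (assoc_zxx z x).
rewrite /assoc; nar.
Qed.

(** The right Moufang identity, in associator form. It follows from the identity
    [(wx,y,z) - (w,xy,z) + (w,x,yz) = w(x,y,z) + (w,x,y)z], valid in every ring,
    at [(y,z,x,x)], [(y,x,x,z)] and [(y,x,z,x)]. *)
Lemma assoc_moufangr x y z : assoc y x (x ** z) = assoc y x z ** x.
Proof.
apply: mulr2n_char0_inj.
lin 1 (amul_congr y (assocC23 x x z)); lin 1 (amul_congl z (assoc_zxx x y)).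
lin (-1) (assocC23 (y ** x) z x); lin 1 (assocC23 y (x ** z) x).
lin (-1) (amul_congr y (assoc_zxx x z)); lin 1 (assoc_zxx x (y ** z)).
lin (-1) (assocC23 y (z ** x) x); lin 1 (assocC23 y z (x ** x)).
lin (-1) (amul_congl x (assocC23 y z x)).
rewrite /assoc; nar.
Qed.

Lemma assoc_sqrl x y z :
  assoc (x ** x) y z = x ** assoc x y z + assoc x y z ** x.
Proof.
lin (-1) (assoc_xxz x (y ** z)); lin 1 (amul_congl z (assoc_xxz x y)).
lin 1 (assocC23 x (x ** y) z); lin (-1) (assocC12 x z (x ** y)).
lin 1 (assoc_moufangr x z y); lin 1 (amul_congl x (assocC12 z x y)).
lin (-1) (amul_congl x (assocC23 x z y)).
rewrite /assoc; nar.
Qed.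

Lemma assoc_moufangl x y z : assoc y x (z ** x) = x ** assoc y x z.
Proof.
lin 1 (amul_congr y (assoc_zxx x z)); lin (-1) (assoc_zxx x (y ** z)).
lin 1 (assocC23 y (z ** x) x); lin (-1) (assocC23 y z (x ** x)).
lin 1 (amul_congl x (assocC23 y z x)).
lin 1 (assocC12 y (x ** x) z); lin (-1) (assoc_sqrl x y z).
lin (-1) (amul_congr x (assocC12 x y z));
  lin (-1) (amul_congl x (assocC12 x y z)).
rewrite /assoc; nar.
Qed.

Lemma assoc_malcev x y z :
  assoc y x (acomm x z) = acomm (assoc y x z) x.
Proof.
lin 1 (assoc_moufangr x y z); lin (-1) (assoc_moufangl x y z).
rewrite /assoc; nar.
Qed.

(** The Jacobian of the commutator algebra. *)
Definition jac x y z : A :=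
  acomm (acomm x y) z + acomm (acomm y z) x + acomm (acomm z x) y.

Lemma jac_assoc x y z : jac x y z = assoc x y z *+ 6.
Proof.
lin (-3) (assocC12 x y z); lin (-2) (assocC23 x y z); lin 2 (assocC23 y z x).
lin 1 (assocC12 z x y); lin (-1) (assocC12 z y x).
rewrite /assoc /jac; nar.
Qed.

(** The commutator algebra is a Malcev algebra. *)
Lemma jac_malcev x y z : jac y x (acomm x z) = acomm (jac y x z) x.
Proof. rewrite !jac_assoc; lin 6 (assoc_malcev x y z); nar. Qed.

Lemma jac_malcev_lin x x' y z :
  jac x y (acomm x' z) + jac x' y (acomm x z)
    = acomm (jac x y z) x' + acomm (jac x' y z) x.
Proof.
lin (-1) (jac_malcev (x + x') y z); lin 1 (jac_malcev x y z).
lin 1 (jac_malcev x' y z); rewrite /jac; nar.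
Qed.

Lemma jac_acomm_skew p q v w :
  jac (acomm p v) q w + jac (acomm p w) q v
    = - acomm (jac p q w) v - acomm (jac p q v) w.
Proof. lin 1 (jac_malcev_lin v w q p); rewrite /jac; nar. Qed.

(** This and [jac_acomm_last] express the values [[J(p, v, w), q]] and
    [J(p, q, [v, w])] through the function [J(p, q, _)], the commutators of its
    values, and the same function with one letter moved into [p] or [q]. *)
Lemma acomm_jac p q v w :
  acomm (jac p v w) q
    = - jac (acomm p v) q w *+ 2 - jac p (acomm q v) w
      - acomm (jac p q w) v - acomm (jac p q v) w *+ 2.
Proof.
apply: mulr2n_char0_inj.
lin (-1) (jac_malcev_lin p q v w); lin (-2) (jac_malcev_lin p v q w).
lin 1 (jac_malcev_lin p v w q); lin (-3) (jac_malcev_lin p w q v).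
rewrite /jac; nar.
Qed.

Lemma jac_acomm_last p q v w :
  jac p q (acomm v w)
    = - jac (acomm p v) q w *+ 2 - jac p (acomm q v) w *+ 2
      - acomm (jac p q w) v - acomm (jac p q v) w *+ 3.
Proof.
apply: mulr2n_char0_inj.
lin (-2) (jac_malcev_lin q w v p); lin (-1) (jac_malcev_lin p q v w).
lin 3 (jac_malcev_lin q w p v); lin (-3) (jac_malcev_lin q v w p).
rewrite /jac; nar.
Qed.

(** The Sagle identity, in terms of right multiplications. *)
Lemma acomm_cycle p y z t :
  acomm (acomm (acomm p y) z) t
    = acomm (acomm (acomm p t) y) z + acomm p (acomm (acomm y z) t)
      + acomm (acomm p (acomm z t)) y + acomm (acomm p z) (acomm y t).
Proof.
apply: mulr2n_char0_inj.
lin (-1) (jac_malcev_lin p y z t); lin 1 (jac_malcev_lin p z t y).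
lin (-1) (jac_malcev_lin p t y z).
rewrite /jac; nar.
Qed.

(** The inner derivation [R_[v,w] + [R_v, R_w]] of a Malcev algebra. *)
Definition mder v w x : A :=
  acomm (acomm x v) w - acomm (acomm x w) v + acomm x (acomm v w).

Lemma mder_acomm v w p q :
  mder v w (acomm p q) = acomm (mder v w p) q + acomm p (mder v w q).
Proof.
apply: mulr2n_char0_inj.
lin 1 (jac_malcev_lin p q v w); lin 2 (jac_malcev_lin p v q w).
lin 1 (jac_malcev_lin p v w q); lin (-1) (jac_malcev_lin p w q v).
rewrite /jac /mder; nar.
Qed.

Lemma mder_jac v w x y z :
  mder v w (jac x y z)
    = jac (mder v w x) y z + jac x (mder v w y) z + jac x y (mder v w z).
Proof.
have D3 x1 y1 z1 : mder v w (acomm (acomm x1 y1) z1) =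
    acomm (acomm (mder v w x1) y1) z1 + acomm (acomm x1 (mder v w y1)) z1
    + acomm (acomm x1 y1) (mder v w z1).
  rewrite !mder_acomm; nar.
have DD x1 y1 : mder v w (x1 + y1) = mder v w x1 + mder v w y1.
  by rewrite /mder; nar.
rewrite {1}/jac 2!DD !D3 /jac; nar.
Qed.

Lemma mder_jacE v w x : mder v w x = jac x v w + acomm x (acomm v w) *+ 2.
Proof. rewrite /mder /jac; nar. Qed.

(** Obtained by applying the derivation [mder q c] to [jac p v w] and then
    solving for [J([p, [q, c]], v, w)]. Apart from [J(J(p, q, c), v, w)] and
    [[J(p, v, w), [q, c]]], the right-hand side only has Jacobians of a word in
    [p] with a word in [q] and a third element. *)
Lemma jac_acomm_acomm p q c v w :
  jac (acomm p (acomm q c)) v w *+ 2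
    = jac (acomm (acomm p v) w) q c - jac (acomm (acomm p w) v) q c
      - jac (acomm p (acomm v w)) q c - jac (jac p q c) v w
      + acomm (jac p v w) (acomm q c) *+ 2
      + jac p (acomm (acomm q c) v) w + jac p (acomm (acomm q v) c) w
      + jac p (acomm q (acomm c v)) w
      - jac p (acomm (acomm q c) w) v - jac p (acomm (acomm q w) c) v
      - jac p (acomm q (acomm c w)) v.
Proof.
have := mder_jac q c p v w; rewrite !mder_jacE => H.
lin (-1) H; rewrite /jac; nar.
Qed.

Lemma jac_skew23 x v w : jac x v w = - jac x w v.
Proof. by rewrite /jac; nar. Qed.

Lemma acomm_congl z x y : x = y -> acomm x z = acomm y z.
Proof. by move->. Qed.

Lemma jac_central x v w : (forall t, acomm x t = 0) -> jac x v w = 0.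
Proof.
move=> cx; rewrite /jac.
lin 1 (acomm_congl w (cx v)); lin (-1) (acomm_congl v (cx w)).
by lin (-1) (cx (acomm v w)); nar.
Qed.

(** The Lie nucleus [{x : J(x, A, A) = 0}] of a Malcev algebra is an ideal:
    for [x] in it, the identities [jac_malcev_lin] and [acomm_jac] give
    [J([x, s], v, w)] two opposite values. *)
Lemma jac_nucleus_acomm x v w s :
  (forall v w, jac x v w = 0) -> jac (acomm x s) v w = 0.
Proof.
move=> nx; apply: (mulrn_char0_eq0 (n := 1) charF0).
lin 1 (jac_malcev_lin v x w s); lin (-1) (nx w (acomm v s)).
lin 1 (acomm_congl v (nx w s)); lin (-1) (acomm_jac v x s w).
lin (-2) (nx (acomm v s) w); lin (-1) (acomm_congl s (nx v w)).
by lin (-2) (acomm_congl w (nx v s)); rewrite /jac; nar.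
Qed.

End Alternative.

(** * Antisymmetrized Jacobians *)

Section Pair.
Variables (F : fieldType) (A : altAlgType F).
Hypothesis charF0 : [pchar F] =i pred0.
Variables (p1 q1 p2 q2 : A).
Implicit Types (a b c d r t v w x y z : A) (s u : seq A).

Lemma lcomm_rcons a s v : lcomm a (rcons s v) = acomm (lcomm a s) v.
Proof. exact: foldl_rcons. Qed.

(** For the antisymmetrized pair [p1 (x) q1 - p2 (x) q2] and words [s], [u] of
    right multiplications, acting on the first and the second factor, [pairJ]
    and [pairC] are the values of [J(_, _, v)] and of the commutator. *)
Definition pairJ s u v : A :=
  jac (lcomm p1 s) (lcomm q1 u) v - jac (lcomm p2 s) (lcomm q2 u) v.

Definition pairC s u : A :=
  acomm (lcomm p1 s) (lcomm q1 u) - acomm (lcomm p2 s) (lcomm q2 u).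

Lemma pairJ_rcons_skew s u v w :
  pairJ (rcons s v) u w + pairJ (rcons s w) u v
    = - acomm (pairJ s u w) v - acomm (pairJ s u v) w.
Proof.
rewrite /pairJ !lcomm_rcons.
lin 1 (jac_acomm_skew charF0 (lcomm p1 s) (lcomm q1 u) v w).
lin (-1) (jac_acomm_skew charF0 (lcomm p2 s) (lcomm q2 u) v w).
nar.
Qed.

Lemma pairJ_acomm_last s u v w :
  pairJ s u (acomm v w)
    = - pairJ (rcons s v) u w *+ 2 - pairJ s (rcons u v) w *+ 2
      - acomm (pairJ s u w) v - acomm (pairJ s u v) w *+ 3.
Proof.
rewrite /pairJ !lcomm_rcons.
lin 1 (jac_acomm_last charF0 (lcomm p1 s) (lcomm q1 u) v w).
lin (-1) (jac_acomm_last charF0 (lcomm p2 s) (lcomm q2 u) v w).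
nar.
Qed.

Lemma pairC_acomm s u v :
  acomm (pairC s u) v
    = pairJ s u v + pairC (rcons s v) u + pairC s (rcons u v).
Proof. rewrite /pairJ /pairC !lcomm_rcons /jac; nar. Qed.

Lemma pairC_swap s u v w :
  pairC s (rcons (rcons u v) w) - pairC s (rcons (rcons u w) v)
    = pairC s (rcons u (acomm v w))
      - pairJ s (rcons u v) w *+ 2 - pairJ (rcons s v) u w
      - acomm (pairJ s u w) v - acomm (pairJ s u v) w *+ 2.
Proof.
rewrite /pairJ /pairC !lcomm_rcons.
lin (-1) (acomm_jac charF0 (lcomm q1 u) (lcomm p1 s) v w).
lin 1 (acomm_jac charF0 (lcomm q2 u) (lcomm p2 s) v w).
rewrite /jac; nar.
Qed.

Lemma pairJ_cycle s y z t d :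
  pairJ (rcons (rcons (rcons s y) z) t) [::] d
    = pairJ (rcons (rcons (rcons s t) y) z) [::] d
      + pairJ (rcons s (acomm (acomm y z) t)) [::] d
      + pairJ (rcons (rcons s (acomm z t)) y) [::] d
      + pairJ (rcons (rcons s z) (acomm y t)) [::] d.
Proof.
rewrite /pairJ !lcomm_rcons /=.
rewrite (acomm_cycle charF0 (lcomm p1 s)) (acomm_cycle charF0 (lcomm p2 s)).
rewrite /jac; nar.
Qed.

Lemma pairC_jac s c v w :
  jac (pairC s [:: c]) v w *+ 2
    = pairJ (rcons (rcons s v) w) [::] c - pairJ (rcons (rcons s w) v) [::] c
      - pairJ (rcons s (acomm v w)) [::] c
      - jac (pairJ s [::] c) v w
      - pairJ (rcons s v) [:: c] w *+ 4 - pairJ s [:: c; v] w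
      - acomm (pairJ s [:: c] w) v *+ 2 - acomm (pairJ s [:: c] v) w *+ 4
      + pairJ s [:: v; c] w + pairJ s [:: acomm c v] w
      - pairJ s [:: c; w] v - pairJ s [:: w; c] v - pairJ s [:: acomm c w] v.
Proof.
rewrite /pairJ /pairC !lcomm_rcons /=.
lin 1 (jac_acomm_acomm charF0 (lcomm p1 s) q1 c v w).
lin (-1) (jac_acomm_acomm charF0 (lcomm p2 s) q2 c v w).
lin 2 (acomm_jac charF0 (lcomm p1 s) (acomm q1 c) v w).
lin (-2) (acomm_jac charF0 (lcomm p2 s) (acomm q2 c) v w).
rewrite /jac; nar.
Qed.
End Pair.

(** * The inductive step *)

Section Step.
Variables (F : fieldType) (A : altAlgType F).
Hypothesis charF0 : [pchar F] =i pred0.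
Variables (p1 q1 p2 q2 : A).
Implicit Types (a b c d r t v w x y z : A).

Notation J := (pairJ p1 q1 p2 q2).
Notation C := (pairC p1 q1 p2 q2).

(** The digits in the names below are the lengths of the two words. *)
Hypothesis pairJ00_central : forall v t, acomm (J [::] [::] v) t = 0.
Hypothesis pairJ00_acomm : forall v w, J [::] [::] (acomm v w) = 0.
Hypothesis pairJ10_central : forall s v t, acomm (J [:: s] [::] v) t = 0.
Hypothesis pairJ10_acomm : forall s v w, J [:: s] [::] (acomm v w) = 0.

(** Under the hypotheses, letters can be moved between the two words. *)
Lemma pairJ01E v w : J [::] [:: v] w = - J [:: v] [::] w.
Proof.
apply: (mulr2n_char0_inj charF0).
have := pairJ_acomm_last charF0 p1 q1 p2 q2 [::] [::] v w; rewrite /= => H.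
lin 1 H; lin (-1) (pairJ00_acomm v w); lin (-1) (pairJ00_central w v);
  lin (-3) (pairJ00_central v w); nar.
Qed.

Lemma pairJ11E s v w : J [:: s] [:: v] w = - J [:: s; v] [::] w.
Proof.
apply: (mulr2n_char0_inj charF0).
have := pairJ_acomm_last charF0 p1 q1 p2 q2 [:: s] [::] v w; rewrite /= => H.
lin 1 H; lin (-1) (pairJ10_acomm s v w); lin (-1) (pairJ10_central s w v);
  lin (-3) (pairJ10_central s v w); nar.
Qed.

Lemma pairJ01_acomm s v w : J [::] [:: s] (acomm v w) = 0.
Proof. by rewrite pairJ01E pairJ10_acomm oppr0. Qed.

Lemma pairJ01_central s v t : acomm (J [::] [:: s] v) t = 0.
Proof. rewrite pairJ01E; lin (-1) (pairJ10_central s v t); nar. Qed.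

Lemma pairJ02E s v w : J [::] [:: s; v] w = J [:: v; s] [::] w.
Proof.
apply: (mulr2n_char0_inj charF0).
have := pairJ_acomm_last charF0 p1 q1 p2 q2 [::] [:: s] v w;
  rewrite /= pairJ11E => H.
lin 1 H; lin (-1) (pairJ01_acomm s v w); lin (-1) (pairJ01_central s w v);
  lin (-3) (pairJ01_central s v w).
nar.
Qed.

Lemma pairJ10_skew s v : J [:: s] [::] v = - J [:: v] [::] s.
Proof.
have := pairJ_rcons_skew charF0 p1 q1 p2 q2 [::] [::] s v; rewrite /= => H.
lin 1 H; lin (-1) (pairJ00_central v s); lin (-1) (pairJ00_central s v); nar.
Qed.

Lemma pairJ10_acomm_head s v w : J [:: acomm v w] [::] s = 0.
Proof. by rewrite pairJ10_skew pairJ10_acomm oppr0. Qed.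

Lemma pairJ01_acomm_head s v w : J [::] [:: acomm v w] s = 0.
Proof. by rewrite pairJ01E pairJ10_acomm_head oppr0. Qed.

Lemma pairJ20_skew23 s v w : J [:: s; v] [::] w = - J [:: s; w] [::] v.
Proof.
have := pairJ_rcons_skew charF0 p1 q1 p2 q2 [:: s] [::] v w; rewrite /= => H.
lin 1 H; lin (-1) (pairJ10_central s w v); lin (-1) (pairJ10_central s v w);
  nar.
Qed.

Lemma jac_pairC01 c v w :
  jac (C [::] [:: c]) v w = J [:: c; v] [::] w + J [:: v; c] [::] w.
Proof.
apply: (mulr2n_char0_inj charF0).
have := pairC_jac charF0 p1 q1 p2 q2 [::] c v w;
  rewrite /= !pairJ10_acomm_head !pairJ01_acomm_head.
rewrite (jac_central _ _ (pairJ00_central c)) !pairJ11E !pairJ02E => H.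
lin 1 H; lin (-2) (pairJ01_central c w v); lin (-4) (pairJ01_central c v w).
lin 1 (pairJ20_skew23 v w c); lin (-1) (pairJ20_skew23 w v c).
lin (-1) (pairJ20_skew23 c v w).
nar.
Qed.

Lemma pairJ20_skew13 s v w : J [:: s; v] [::] w = - J [:: w; v] [::] s.
Proof.
lin (-1) (jac_pairC01 v s w); lin (-1) (jac_pairC01 v w s).
lin 1 (jac_skew23 (C [::] [:: v]) s w); lin (-1) (pairJ20_skew23 v s w); nar.
Qed.

Lemma pairJ20_skew12 s v w : J [:: s; v] [::] w = - J [:: v; s] [::] w.
Proof. by rewrite pairJ20_skew23 pairJ20_skew13 opprK pairJ20_skew23. Qed.

Lemma pairC01_nucleus c v w : jac (C [::] [:: c]) v w = 0.
Proof. by rewrite jac_pairC01 pairJ20_skew12 addNr. Qed.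

(** [C(s, t) - C(t, s)] is a sum of elements of the Lie nucleus: [[C(1, t), s]],
    [[C(1, s), t]], [C(1, [t, s])] and a central element. *)
Lemma jac_pairC11_sym s t v w :
  jac (C [:: s] [:: t]) v w = jac (C [:: t] [:: s]) v w.
Proof.
have E1 := pairC_acomm p1 q1 p2 q2 [::] [:: t] s; rewrite /= in E1.
have E2 := pairC_acomm p1 q1 p2 q2 [::] [:: s] t; rewrite /= in E2.
have E3 := pairC_swap charF0 p1 q1 p2 q2 [::] [::] t s; rewrite /= in E3.
have E : C [:: s] [:: t] = C [:: t] [:: s] + acomm (C [::] [:: t]) s
    - acomm (C [::] [:: s]) t - C [::] [:: acomm t s]
    - J [:: s] [::] t.
  lin (-1) E1; lin 1 E2; lin (-1) E3; lin 1 (pairJ01E t s);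
    lin 1 (pairJ01E s t).
  lin 1 (pairJ00_central s t); lin 2 (pairJ00_central t s).
  nar.
rewrite E; lin 1 (jac_nucleus_acomm charF0 v w s (pairC01_nucleus t)).
lin (-1) (jac_nucleus_acomm charF0 v w t (pairC01_nucleus s)).
lin (-1) (pairC01_nucleus (acomm t s) v w).
lin (-1) (jac_central v w (pairJ10_central s t)).
rewrite /jac; nar.
Qed.

(** In the application, [u4], [g4] and [h4] are 6 times the elements
    [u_(n+1)(..., a, b, c, d)], [[u_n(..., a, b, c), d]] and
    [u_n(..., a, b, [c, d])]. *)
Definition u4 a b c d := J [:: a; b; c] [::] d.
Definition g4 a b c d := acomm (J [:: a; b] [::] c) d.
Definition h4 a b c d := J [:: a; b] [::] (acomm c d).

Lemma g4_skew12 a b c d : g4 a b c d = - g4 b a c d.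
Proof. rewrite /g4 pairJ20_skew12; nar. Qed.

Lemma g4_skew23 a b c d : g4 a b c d = - g4 a c b d.
Proof. rewrite /g4 pairJ20_skew23; nar. Qed.

Lemma h4_skew12 a b c d : h4 a b c d = - h4 b a c d.
Proof. exact: pairJ20_skew12. Qed.

Lemma h4_skew34 a b c d : h4 a b c d = - h4 a b d c.
Proof. rewrite /h4 /pairJ /jac; nar. Qed.

Lemma u4_skew34 a b c d :
  u4 a b c d + u4 a b d c = - g4 a b d c - g4 a b c d.
Proof.
have := pairJ_rcons_skew charF0 p1 q1 p2 q2 [:: a; b] [::] c d; rewrite /= => H.
by rewrite /u4 /g4; lin 1 H; nar.
Qed.

(** [h4_sort a b c d] and [g4_sort a b c d] put the arguments of [h4] in the
    pairs of places 1, 2 and 3, 4, and the first three arguments of [g4], in the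
    order of [a b c d]. *)
Ltac h4_sort a b c d :=
  rewrite ?(h4_skew12 b a) ?(h4_skew12 c a) ?(h4_skew12 d a)
          ?(h4_skew12 c b) ?(h4_skew12 d b) ?(h4_skew12 d c)
          ?(h4_skew34 _ _ b a) ?(h4_skew34 _ _ c a) ?(h4_skew34 _ _ d a)
          ?(h4_skew34 _ _ c b) ?(h4_skew34 _ _ d b) ?(h4_skew34 _ _ d c).

Ltac g4_sort a b c d :=
  do 3! rewrite ?(g4_skew12 b a) ?(g4_skew12 c a) ?(g4_skew12 d a)
          ?(g4_skew12 c b) ?(g4_skew12 d b) ?(g4_skew12 d c)
          ?(g4_skew23 _ b a) ?(g4_skew23 _ c a) ?(g4_skew23 _ d a)
          ?(g4_skew23 _ c b) ?(g4_skew23 _ d b) ?(g4_skew23 _ d c).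

Lemma pairJ20_acomm1 a b c d : J [:: acomm a b; c] [::] d = h4 c d a b.
Proof. by rewrite pairJ20_skew12 pairJ20_skew23 opprK. Qed.

Lemma pairJ20_acomm2 a b c d : J [:: c; acomm a b] [::] d = - h4 c d a b.
Proof. by rewrite pairJ20_skew23. Qed.

Lemma u4_cycle y z t d :
  u4 y z t d = u4 t y z d + h4 y d z t - h4 z d y t.
Proof.
have := pairJ_cycle charF0 p1 q1 p2 q2 [::] y z t d; rewrite /= => H.
rewrite /u4; lin 1 H; lin 1 (pairJ10_acomm_head d (acomm y z) t).
lin 1 (pairJ20_acomm1 z t y d); lin 1 (pairJ20_acomm2 y t z d); nar.
Qed.

(** The cyclic permutation of [u4_cycle] has order 3. *)
Lemma h4_cycle a b c d : h4 a d b c + h4 b d c a + h4 c d a b = 0.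
Proof.
apply: (mulrn_char0_eq0 (n := 1) charF0).
lin (-1) (u4_cycle a b c d); lin (-1) (u4_cycle c a b d).
lin (-1) (u4_cycle b c a d).
rewrite (h4_skew34 a d c b) (h4_skew34 b d a c) (h4_skew34 c d b a); nar.
Qed.

Lemma h4_swap a b c d : h4 a b c d = h4 c d a b.
Proof.
apply: (mulr2n_char0_inj charF0).
lin (-1) (h4_cycle b c d a); lin 1 (h4_cycle a c d b).
lin 1 (h4_cycle a b d c); lin (-1) (h4_cycle a b c d).
h4_sort a b c d; nar.
Qed.

Lemma pairJ21E s v w t :
  J [:: s; v] [:: w] t *+ 2
    = - u4 s v w t *+ 2 - h4 s v w t - g4 s v t w - g4 s v w t *+ 3.
Proof.
have := pairJ_acomm_last charF0 p1 q1 p2 q2 [:: s; v] [::] w t; rewrite /= => H.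
rewrite /u4 /h4 /g4; lin 1 H; nar.
Qed.

Lemma pairJ12E s w t v :
  J [:: s] [:: w; t] v *+ 2
    = u4 s t w v *+ 2 + h4 s w t v + h4 s t w v + g4 s w v t + g4 s t v w.
Proof.
have := pairJ_acomm_last charF0 p1 q1 p2 q2 [:: s] [:: w] t v; rewrite /= => H.
lin 1 H; lin (-1) (pairJ21E s t w v); lin (-1) (pairJ11E s w (acomm t v)).
lin (-1) (acomm_congl t (pairJ11E s w v));
  lin (-3) (acomm_congl v (pairJ11E s w t)).
lin 3 (g4_skew23 s w t v).
rewrite /g4 /h4 /u4; nar.
Qed.

(** [pairC_jac] with all the forms moved to the first word. *)
Lemma jac_pairC11 s t v w :
  jac (C [:: s] [:: t]) v w *+ 2
    = (u4 s v t w + u4 s t v w) *+ 2 + g4 s v w t - g4 s t v w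
      + g4 s t w v *+ 2 + h4 s t v w *+ 2 + h4 s v t w.
Proof.
apply: (mulr2n_char0_inj charF0).
have := pairC_jac charF0 p1 q1 p2 q2 [:: s] t v w; rewrite /= => H.
lin 2 H; lin (-4) (pairJ21E s v t w); lin (-1) (pairJ12E s t v w);
  lin 1 (pairJ12E s v t w).
lin (-1) (pairJ12E s t w v); lin (-1) (pairJ12E s w t v);
  lin (-2) (pairJ20_acomm2 v w s t).
lin 2 (pairJ11E s (acomm t v) w); lin (-2) (pairJ20_acomm2 t v s w).
lin (-2) (pairJ11E s (acomm t w) v); lin 2 (pairJ20_acomm2 t w s v).
lin (-2) (jac_central v w (pairJ10_central s t));
  lin (-4) (acomm_congl v (pairJ11E s t w)).
lin (-8) (acomm_congl w (pairJ11E s t v)).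
lin 2 (u4_skew34 s v w t); lin (-2) (u4_skew34 s w v t).
lin (-2) (u4_skew34 s t v w).
rewrite ?(h4_skew34 s t w v) ?(h4_skew34 s v w t) ?(h4_skew34 s w v t).
rewrite ?(g4_skew23 s w v t) ?(g4_skew23 s v t w) ?(g4_skew23 s w t v).
rewrite /u4 /g4 /h4.
nar.
Qed.

(** The relation [J(C(s, t) - C(t, s), v, w) = 0], with the values of [u4]
    cancelled in pairs by [u4_cycle]. *)
Lemma g4_h4_relation s t v w :
  h4 s t v w *+ 3 + g4 s v w t - g4 t v w s - g4 s t v w *+ 2
    + g4 s t w v *+ 4 = 0.
Proof.
have E : jac (C [:: s] [:: t]) v w *+ 2 = jac (C [:: t] [:: s]) v w *+ 2.
  by rewrite jac_pairC11_sym.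
lin 1 E; lin (-1) (jac_pairC11 s t v w); lin 1 (jac_pairC11 t s v w).
lin (-2) (u4_cycle s v t w); lin 2 (u4_cycle t v s w).
lin (-3) (h4_cycle t v w s); lin (-4) (h4_swap s t v w).
lin 2 (h4_swap s v t w); lin (-1) (h4_swap s w t v).
h4_sort s t v w; g4_sort s t v w; rewrite /u4.
nar.
Qed.

Lemma g4_skew34 a b c d : g4 a b c d = - g4 a b d c.
Proof.
apply: (mulr2n_char0_inj charF0).
lin 1 (g4_h4_relation a b c d); lin 1 (g4_h4_relation a b d c).
h4_sort a b c d; g4_sort a b c d; nar.
Qed.

(** With [g4] skew-symmetric, [g4_h4_relation] reads [3 h4 = 4 g4], and
    [h4_cycle] becomes [12 g4 = 0]. *)
Lemma g4_eq0 a b c d : g4 a b c d = 0.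
Proof.
apply: (mulrn_char0_eq0 (n := 11) charF0).
lin (-3) (h4_cycle b c d a); lin (-1) (g4_h4_relation a b c d).
lin 1 (g4_h4_relation a c b d); lin (-1) (g4_h4_relation a d b c).
h4_sort a b c d; g4_sort a b c d.
rewrite (g4_skew34 a b d c) (g4_skew34 a c d b) (g4_skew34 b c d a).
rewrite (g4_skew23 a c b d) (g4_skew23 b c a d) (g4_skew12 b a c d); nar.
Qed.

Lemma h4_eq0 a b c d : h4 a b c d = 0.
Proof.
apply: (mulrn_char0_eq0 (n := 2) charF0).
by lin 1 (g4_h4_relation a b c d); rewrite !g4_eq0; nar.
Qed.
End Step.

(** * The elements u_n *)

Section Main.
Variables (F : fieldType) (A : altAlgType F).
Hypothesis charF0 : [pchar F] =i pred0.
Variable a : A.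
Implicit Types (b c d t v w x y z : A) (s P Q : seq A).

Notation J := (pairJ a (a ** a) (a ** a) a).

Lemma assoc_a_sqr v : assoc a (a ** a) v = 0.
Proof.
lin 1 (assocC12 a (a ** a) v); lin (-1) (assoc_sqrl charF0 a a v).
lin (-1) (amul_congr a (assoc_xxz a v));
  lin (-1) (amul_congl a (assoc_xxz a v)).
nar.
Qed.

Lemma pairJ_sqr_nil v : J [::] [::] v = 0.
Proof.
rewrite /pairJ /= !jac_assoc; lin 12 (assoc_a_sqr v).
lin (-6) (assocC12 a (a ** a) v); nar.
Qed.

Lemma acomm_sqr v : acomm (a ** a) v = a ** acomm a v + acomm a v ** a.
Proof.
lin 1 (assoc_xxz a v); lin 2 (assoc_zxx a v); lin (-1) (assocC12 a v a).
rewrite /assoc; nar.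
Qed.

(** With [p = [a, v]], one has [[a^2, v] = ap + pa]; by the identity
    [(ax + xa, y, w) = a(x,y,w) + (x,y,w)a + x(a,y,w) + (a,y,w)x], both
    associators are equal to [a(p,a,w) + (p,a,w)a]. *)
Lemma pairJ_sqr_seq1 v w : J [:: v] [::] w = 0.
Proof.
rewrite /pairJ /= acomm_sqr !jac_assoc; set p := acomm a v.
lin 6 (assocC12 p (a ** a) w); lin (-6) (assoc_sqrl charF0 a p w).
lin (-6) (assoc_sqrl charF0 (a + p) a w); lin 6 (assoc_sqrl charF0 a a w).
lin 6 (assoc_sqrl charF0 p a w).
lin (-6) (amul_congr a (assocC12 a p w));
  lin (-6) (amul_congl a (assocC12 a p w)).
lin (-6) (amul_congr p (assoc_xxz a w));
  lin (-6) (amul_congl p (assoc_xxz a w)).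
rewrite /assoc; nar.
Qed.

Lemma pairJ_cat P s v :
  J (P ++ s) [::] v
    = pairJ (lcomm a P) (a ** a) (lcomm (a ** a) P) a s [::] v.
Proof. by rewrite /pairJ /lcomm !foldl_cat. Qed.

(** Both properties for the words one and two letters shorter are the hypotheses
    of the inductive step, for the pairs [aP'], [a^2] and [a^2 P'], [a], where
    [P'] is [P] without its last two letters. *)
Lemma pairJ_sqr_central P :
  (forall v t, acomm (J P [::] v) t = 0) /\
  (forall v w, J P [::] (acomm v w) = 0).
Proof.
have acomm0 t : acomm 0 t = 0 :> A by nar.
have [n] := ubnP (size P); elim: n P => // n IHn P.
case/lastP: P => [|P y]; first by split=> *; rewrite pairJ_sqr_nil ?acomm0.
case/lastP: P => [|P x]; first by split=> *; rewrite pairJ_sqr_seq1 ?acomm0.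
rewrite !size_rcons ltnS -!cats1 -catA /= => sP.
have [c1 k1] := IHn P (ltnW sP).
have IH1 z : (size (rcons P z) < n)%N by rewrite size_rcons.
have c2 z := (IHn _ (IH1 z)).1; have k2 z := (IHn _ (IH1 z)).2.
rewrite -[P]cats0 in c1 k1.
have c3 := @g4_eq0 _ _ charF0 (lcomm a P) (a ** a) (lcomm (a ** a) P) a.
have k3 := @h4_eq0 _ _ charF0 (lcomm a P) (a ** a) (lcomm (a ** a) P) a.
rewrite /g4 /h4 in c3 k3.
split=> [v t|v w]; rewrite pairJ_cat ?c3 ?k3 // => *;
  by rewrite -pairJ_cat ?cats1 ?(c1, k1, c2, k2).
Qed.

Lemma pairJ_sqr_skew_last P x v :
  J (rcons P x) [::] v = - J (rcons P v) [::] x.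
Proof.
have [c _] := pairJ_sqr_central P.
lin 1 (pairJ_rcons_skew charF0 a (a ** a) (a ** a) a P [::] x v).
lin (-1) (c v x); lin (-1) (c x v); nar.
Qed.

Lemma pairJ_sqr_skew_last3 P x y v :
  J (P ++ [:: x; y]) [::] v = - J (P ++ [:: y; x]) [::] v.
Proof.
have [c1 k1] := pairJ_sqr_central P.
have c2 z := (pairJ_sqr_central (rcons P z)).1.
have k2 z := (pairJ_sqr_central (rcons P z)).2.
rewrite -[P]cats0 in c1 k1.
rewrite !pairJ_cat; apply: pairJ20_skew12 => // *;
  by rewrite -pairJ_cat ?cats1 ?(c1, k1, c2, k2).
Qed.

Lemma lcommDl x y s : lcomm (x + y) s = lcomm x s + lcomm y s :> A.
Proof.
elim: s x y => [//|z s IHs] x y /=; rewrite -IHs; congr lcomm; nar.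
Qed.

Notation u := (u_elt a).

Lemma pairJ_sqr_u_elt P v : J P [::] v = u (rcons P v) *+ 6.
Proof. rewrite u_elt_rcons /pairJ !jac_assoc /=; nar. Qed.

Lemma u_elt_central s t : acomm (u s) t = 0.
Proof.
apply: (mulrn_char0_eq0 (n := 5) charF0).
case/lastP: s => [|P v]; first by rewrite /=; nar.
by lin 1 ((pairJ_sqr_central P).1 v t); rewrite pairJ_sqr_u_elt; nar.
Qed.

Lemma u_elt_rcons_acomm P v w : u (rcons P (acomm v w)) = 0.
Proof.
apply: (mulrn_char0_eq0 (n := 5) charF0).
by rewrite -pairJ_sqr_u_elt; exact: (pairJ_sqr_central P).2.
Qed.

Lemma u_elt_skew_last P x y : u (P ++ [:: x; y]) = - u (P ++ [:: y; x]).
Proof.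
apply/eqP; rewrite -addr_eq0; apply/eqP.
apply: (mulrn_char0_eq0 (n := 5) charF0).
have := pairJ_sqr_skew_last P x y;
  rewrite !pairJ_sqr_u_elt -!cats1 -!catA /= => H.
by lin 1 H; nar.
Qed.

Lemma u_elt_skew_last3 P x y z :
  u (P ++ [:: x; y; z]) = - u (P ++ [:: y; x; z]).
Proof.
apply/eqP; rewrite -addr_eq0; apply/eqP.
apply: (mulrn_char0_eq0 (n := 5) charF0).
have := pairJ_sqr_skew_last3 P x y z;
  rewrite !pairJ_sqr_u_elt -!cats1 -!catA /= => H.
by lin 1 H; nar.
Qed.

Lemma u_elt_cycle P y z t Q d :
  u (P ++ [:: y, z, t & rcons Q d])
    = u (P ++ [:: t, y, z & rcons Q d])
      + u (P ++ acomm (acomm y z) t :: rcons Q d)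
      + u (P ++ [:: acomm z t, y & rcons Q d])
      + u (P ++ [:: z, acomm y t & rcons Q d]).
Proof.
rewrite -!rcons_cons -!rcons_cat !u_elt_rcons.
have E p : lcomm p (P ++ [:: y, z, t & Q]) =
    lcomm p (P ++ [:: t, y, z & Q]) + lcomm p (P ++ acomm (acomm y z) t :: Q)
    + lcomm p (P ++ [:: acomm z t, y & Q])
    + lcomm p (P ++ [:: z, acomm y t & Q]).
  by rewrite /lcomm !foldl_cat /= (acomm_cycle charF0) -!/(lcomm _ _) !lcommDl.
rewrite !E /assoc; nar.
Qed.

(** By induction on the number of arguments, then on the number of arguments
    after the transposed ones. *)
Lemma u_elt_skew_adjacent P x y Q :
  u (P ++ [:: x, y & Q]) = - u (P ++ [:: y, x & Q]).
Proof.
have [n] := ubnP (size (P ++ Q)); elim: n P x y Q => // n IHn P x y Q.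
rewrite size_cat ltnS => sPQ.
(* Skew-symmetry in fewer arguments moves a commutator to the last place. *)
have kill P' Q' b c : (size P' + size Q' <= n)%N ->
    u (P' ++ acomm b c :: Q') = 0.
  elim: Q' P' => [|z Q' IHQ] P' s'; first by rewrite cats1 u_elt_rcons_acomm.
  rewrite IHn ?size_cat ?(leq_trans _ s') ?addnS //.
  by rewrite -cat_rcons IHQ ?oppr0 // size_rcons addSn -addnS.
elim: Q P x y sPQ => [|z Q IHQ] P x y sPQ; first exact: u_elt_skew_last.
case/lastP: Q IHQ sPQ => [|Q d] IHQ sPQ; first exact: u_elt_skew_last3.
(* The correction terms of u_elt_cycle have a commutator as an argument. *)
have cyc b c t : u (P ++ [:: b, c, t & rcons Q d]) =
    u (rcons P t ++ [:: b, c & rcons Q d]).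
  rewrite u_elt_cycle cat_rcons -[P ++ [:: c, _ & _]]cat_rcons.
  have sP : (size P + (size Q).+2 <= n)%N by move: sPQ; rewrite /= size_rcons.
  rewrite !kill ?addr0 ?size_rcons //= ?size_rcons ?addSnnS //.
  by apply: leq_trans sP; rewrite leq_add2l.
rewrite !cyc; apply: IHQ.
by move: sPQ; rewrite /= !size_rcons addSnnS.
Qed.

Lemma u_elt_skew_swap P x Q y R :
  u (P ++ x :: Q ++ y :: R) = - u (P ++ y :: Q ++ x :: R).
Proof.
elim: Q P => [|z Q IHQ] P /=; first exact: u_elt_skew_adjacent.
rewrite u_elt_skew_adjacent -cat_rcons IHQ opprK cat_rcons.
exact: u_elt_skew_adjacent.
Qed.

Lemma u_elt_center s : center (u s).
Proof.
split=> [q r|q]; last exact: u_elt_central.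
apply: (mulrn_char0_eq0 (n := 5) charF0).
by rewrite -jac_assoc; apply: jac_central => t; exact: u_elt_central.
Qed.

Lemma u_elt_skew_tperm n (f : 'I_n -> A) (i j : 'I_n) :
  i != j -> u [seq f (tperm i j k) | k <- enum 'I_n]
            = - u [seq f k | k <- enum 'I_n].
Proof.
wlog ltij : i j / (i < j)%N => [W|] ij.
  case: (ltngtP i j) => [?|?|/val_inj eij]; first exact: W.
    by rewrite tpermC; apply: W => //; rewrite eq_sym.
  by rewrite eij eqxx in ij.
have E : enum 'I_n = take i (enum 'I_n) ++ i ::
    take (j - i.+1) (drop i.+1 (enum 'I_n)) ++ j :: drop j.+1 (enum 'I_n).
  have sz : size (enum 'I_n) = n by rewrite size_enum_ord.
  rewrite -{1}[enum 'I_n](cat_take_drop i); congr (_ ++ _).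
  rewrite (drop_nth i) ?sz // nth_ord_enum; congr (_ :: _).
  rewrite -{1}[drop i.+1 _](cat_take_drop (j - i.+1)); congr (_ ++ _).
  by rewrite drop_drop subnK // (drop_nth i) ?sz // nth_ord_enum.
have := enum_uniq 'I_n; rewrite {}E.
set P := take _ _; set Q := take _ _; set R := drop _ _.
set s := _ ++ _ => s_uniq.
have: uniq (i :: j :: P ++ Q ++ R).
  rewrite -(@perm_uniq _ s) //; apply/seq.permP => p.
  by rewrite /s /= !count_cat /= count_cat /=; lia.
rewrite /= !inE !mem_cat !negb_or -!andbA.
case/and5P => _ iP iQ iR /and4P[jP jQ jR _].
have fE T : i \notin T -> j \notin T ->
    [seq f (tperm i j k) | k <- T] = [seq f k | k <- T].
  move=> iT jT; apply/eq_in_map => k kT; rewrite tpermD //.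
    by apply: contraNneq iT => ->.
  by apply: contraNneq jT => ->.
rewrite /s !map_cat /= !map_cat /= !fE // tpermL tpermR.
exact: u_elt_skew_swap.
Qed.

Lemma u_elt_skew_perm n (f : 'I_n -> A) (s : 'S_n) :
  u [seq f (s k) | k <- enum 'I_n]
    = (-1) ^+ s *: u [seq f k | k <- enum 'I_n].
Proof.
have [ts -> /allP ts_neq] := prod_tpermP s.
elim: ts ts_neq f => [|[i j] ts IHts] ts_neq f.
  rewrite big_nil odd_perm1 scale1r; congr u_elt.
  by apply/eq_map => k; rewrite perm1.
have ij : i != j by exact: (ts_neq (i, j) (mem_head _ _)).
rewrite big_cons odd_permM odd_tperm ij signr_addb expr1 mulN1r scaleNr.
rewrite -IHts => [|t t_ts]; last by apply: ts_neq; rewrite inE t_ts orbT.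
set g := bigop _ _ _.
rewrite -(u_elt_skew_tperm (fun k => f (g k)) ij); congr u_elt.
by apply/eq_map => k; rewrite permM.
Qed.
End Main.

Theorem theorem2p1 (F : fieldType) (charF0 : [pchar F] =i pred0)
    (a : Alt F) (Ha : SMalc a) (n : nat) (Hn : (2 <= n)%N) :
  [/\ forall x : n.-tuple nat, center (u_elt a [seq agen i | i <- x]),
      forall (x : n.-tuple nat) (s : 'S_n),
        u_elt a [seq agen (tnth x (s i)) | i <- enum 'I_n]
        = (-1) ^+ s *: u_elt a [seq agen i | i <- x]
    & forall (x : n.-1.-tuple nat) (b c : Alt F), SMalc b -> SMalc c ->
        u_elt a (rcons [seq agen i | i <- x] (acomm b c)) = 0].
Proof.
have seqE (x : n.-tuple nat) :
    [seq agen i | i <- x]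
    = [seq agen (tnth x k) | k <- enum 'I_n] :> seq (Alt F).
  by rewrite -{1}[x : seq nat]map_tnth_enum -map_comp.
split=> [x|x s|x b c _ _].
- exact: u_elt_center.
- by rewrite seqE -(u_elt_skew_perm charF0 a (fun k => agen (tnth x k))).
- exact: u_elt_rcons_acomm.
Qed.
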